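(* Let $(\xi_0,\xi_{12},W_1,W_2)$ be the coordinates on $\mathbb{C}^4$. Any non-singular quadric hypersurface in $\mathbb{CP}^3$ is equivalent under the action of $SO_\circ(1,5)$ on $\mathbb{CP}^3$ to the zero set of $$e^{\lambda+i\nu}\xi_0^2+e^{-\lambda+i\nu}\xi_{12}^2+e^{\mu-i\nu}W_1^2+e^{-\mu-i\nu}W_2^2$$ for some $\lambda,\mu,\nu\in\mathbb{R}$, or to the zero set of $$i(\xi_0^2+\xi_{12}^2)-k\,\xi_0W_1+k\,\xi_{12}W_2-\xi_0W_2+\xi_{12}W_1$$ for some $k\in[0,1)$.
   Context: Identify $\mathbb{C}^4$ with the right $\mathbb{H}$-module $\mathbb{H}^2$ by $(\xi_0,\xi_{12},W_1,W_2)\mapsto(\xi_0+j\xi_{12},\,W_1+jW_2)$, so right multiplication by $j$ is $(c_1,c_2,c_3,c_4)\mapsto(-\bar c_2,\bar c_1,-\bar c_4,\bar c_3)$. $SL(2,\mathbb{H})$ is the group of complex $4\times4$ matrices of determinant $1$ commuting with this map; it acts on $\mathbb{CP}^3$, and $SL(2,\mathbb{H})/\{\pm1\}\cong SO_\circ(1,5)$ (the identity component of $O(1,5)$) is the group of orientation-preserving conformal transformations of $S^4=\mathbb{HP}^1$. This defines the action of $SO_\circ(1,5)$ on $\mathbb{CP}^3$. *)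

(* Defs.v *)
From HB Require Import structures.
From mathcomp Require Import all_boot all_order all_algebra.
From mathcomp Require Import complex.
From mathcomp Require Import mpoly.
From mathcomp Require Import boolp classical_sets reals.
From mathcomp Require Import -(notations) sequences exp trigo.

Set Implicit Arguments.
Unset Strict Implicit.
Unset Printing Implicit Defensive.

Import Order.TTheory GRing.Theory Num.Theory.

Local Open Scope ring_scope.
Local Open Scope complex_scope.
Local Open Scope classical_set_scope.

Definition Cexp (R : realType) (z : R[i]) : R[i] :=
  (expR (complex.Re z))%:C * (cos (complex.Im z) +i* sin (complex.Im z)).

(* Points of CP^3 are the lines through the origin in C^4; subsets of CP^3 are
   sets of subspaces contained in [CP3]. *)
Definition CP3 (R : realType) : set {vspace 'cV[R[i]]_4} :=
  [set L | \dim L = 1%N].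

(* Coordinates on C^4 are listed in the order (xi_0, xi_12, W_1, W_2). *)
Definition zero_set (R : realType) (q : {mpoly R[i][4]}) :
    set {vspace 'cV[R[i]]_4} :=
  [set L | CP3 L /\
    forall v : 'cV[R[i]]_4, v \in L -> q.@[fun i => v i 0] = 0].

(* The zero polynomial is 2-homogeneous in the library, but the gradient
   condition rules it out. *)
Definition nonsingular_quadric (R : realType)
    (S : set {vspace 'cV[R[i]]_4}) : Prop :=
  exists q : {mpoly R[i][4]},
    [/\ q \is 2.-homog,
        (forall v : 'cV[R[i]]_4, v != 0 -> q.@[fun i => v i 0] = 0 ->
           exists i : 'I_4, (q^`M(i)).@[fun i => v i 0] != 0)
      & S = zero_set q].

(* Right multiplication by j under the identification of c = (c1, c2, c3, c4)
   with (c1 + j c2, c3 + j c4) in H^2. *)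
Definition right_mulj (R : realType) (c : 'cV[R[i]]_4) : 'cV[R[i]]_4 :=
  \col_(i < 4) [:: - (c 1 0)^*; (c 0 0)^*; - (c 3 0)^*; (c 2 0)^*]`_i.

Definition SL2H (R : realType) : set 'M[R[i]]_4 :=
  [set g | \det g = 1 /\
    forall c : 'cV[R[i]]_4, g *m right_mulj c = right_mulj (g *m c)].

Definition proj_act (R : realType) (g : 'M[R[i]]_4)
    (L : {vspace 'cV[R[i]]_4}) : {vspace 'cV[R[i]]_4} :=
  (linfun (mulmx g : 'cV[R[i]]_4 -> 'cV[R[i]]_4) @: L)%VS.

(* SO_o(1,5) acts on CP^3 through SL(2,H)/{+1,-1}; as -1 acts trivially, its
   orbits are those of SL(2,H). *)
Definition SO15_equivalent (R : realType)
    (S S' : set {vspace 'cV[R[i]]_4}) : Prop :=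
  exists2 g : 'M[R[i]]_4, SL2H g & proj_act g @` S = S'.

Definition diagonal_form (R : realType) (l m n : R) : {mpoly R[i][4]} :=
  Cexp (l +i* n) *: 'X_0 ^+ 2 + Cexp (- l +i* n) *: 'X_1 ^+ 2
  + Cexp (m +i* - n) *: 'X_2 ^+ 2 + Cexp (- m +i* - n) *: 'X_3 ^+ 2.

Definition exceptional_form (R : realType) (k : R) : {mpoly R[i][4]} :=
  'i *: ('X_0 ^+ 2 + 'X_1 ^+ 2) - k%:C *: ('X_0 * 'X_2)
  + k%:C *: ('X_1 * 'X_3) - 'X_0 * 'X_3 + 'X_1 * 'X_2.

(* Main.v *)
(* Let [Q] be a nondegenerate symmetric form, [vj] the image of [v] under right
   multiplication by j, and [Q'(v, w) = conj Q(vj, wj)].  The operator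
   [Q^-1 Q'] has an eigenvector [v] with [Q(v, vj) = 0]; after a rescaling of
   [Q] its eigenvalue [l] satisfies [l >= 1].  If [Q(v, v) <> 0], the
   [Q]-orthogonal complement of the quaternionic line [vH] is again a
   quaternionic line, any quaternionic line contains a [w] with
   [Q(w, wj) = 0], and [Q] is diagonal in the frame [v, vj, w, wj].  If
   [Q(v, v) = 0], the line [vH] is isotropic, and for a suitable dual vector [w]
   the only invariant besides [l] is whether
   [f = Q(wj, wj) - l conj Q(w, w)] vanishes: if it does, the frame built on
   [w + v] and [w - v] is diagonal, and otherwise [Q] is equivalent to the
   exceptional form with [k = (l - 1) / (l + 1)]. *)

Require Import Defs.
From mathcomp Require Import all_boot all_order all_algebra.
From mathcomp Require Import complex classical_sets reals.
From mathcomp Require Import mpoly ring.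
From mathcomp Require Import -(notations) exp trigo.

Set Implicit Arguments.
Unset Strict Implicit.
Unset Printing Implicit Defensive.

Import Order.TTheory GRing.Theory Num.Theory.

Local Open Scope ring_scope.

(** * Coordinates and determinants in dimension four *)

Lemma ord4P (i : 'I_4) : [\/ i = 0, i = 1, i = 2 | i = 3].
Proof.
by case: i => [[|[|[|[|//]]]] lti]; [constructor 1|constructor 2|constructor 3|
  constructor 4]; apply: val_inj.
Qed.

Lemma sum_ord4 (V : nmodType) (F : 'I_4 -> V) :
  \sum_i F i = F 0 + F 1 + F 2 + F 3.
Proof.
rewrite !big_ord_recl big_ord0 addr0 !addrA.
by congr (F _ + F _ + F _ + F _); apply: val_inj.
Qed.

Lemma col4P (R : Type) (u v : 'cV[R]_4) :
  u 0 0 = v 0 0 -> u 1 0 = v 1 0 -> u 2 0 = v 2 0 -> u 3 0 = v 3 0 -> u = v.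
Proof.
by move=> ? ? ? ?; apply/colP => i; case: (ord4P i) => ->.
Qed.

(** With entries indexed by natural numbers, a minor is again of this shape, so cofactor expansions
    reduce by computation. *)
Definition natmx (R : Type) m n (f : nat -> nat -> R) : 'M_(m, n) :=
  \matrix_(i, j) f i j.

Lemma minor_natmx (R : Type) m n (i0 : 'I_m.+1) (j0 : 'I_n.+1)
    (f : nat -> nat -> R) :
  row' i0 (col' j0 (natmx m.+1 n.+1 f)) =
  natmx m n (fun i j => f (bump i0 i) (bump j0 j)).
Proof. by apply/matrixP => i j; rewrite !mxE. Qed.

Lemma det_natmx22 (R : comPzRingType) (f : nat -> nat -> R) :
  \det (natmx 2 2 f) =
  f 0%N 0%N * f 1%N 1%N - f 0%N 1%N * f 1%N 0%N.
Proof.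
rewrite (expand_det_row _ ord0) !big_ord_recl big_ord0 /cofactor !minor_natmx.
by rewrite !det_mx11 !mxE /=; ring.
Qed.

Lemma det_natmx33 (R : comPzRingType) (f : nat -> nat -> R) :
  \det (natmx 3 3 f) =
    f 0%N 0%N * (f 1%N 1%N * f 2%N 2%N - f 1%N 2%N * f 2%N 1%N)
  - f 0%N 1%N * (f 1%N 0%N * f 2%N 2%N - f 1%N 2%N * f 2%N 0%N)
  + f 0%N 2%N * (f 1%N 0%N * f 2%N 1%N - f 1%N 1%N * f 2%N 0%N).
Proof.
rewrite (expand_det_row _ ord0) !big_ord_recl big_ord0 /cofactor !minor_natmx.
by rewrite !det_natmx22 !mxE /bump /=; ring.
Qed.

(** Laplace expansion along the first two rows: [g] and [h] are the minors of the upper and the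
    lower two rows. *)
Lemma det_natmx44 (R : comPzRingType) (f : nat -> nat -> R) (g := fun k l =>
    f 0%N k * f 1%N l - f 0%N l * f 1%N k) (h := fun k l =>
    f 2%N k * f 3%N l - f 2%N l * f 3%N k) :
  \det (natmx 4 4 f) =
    g 0%N 1%N * h 2%N 3%N - g 0%N 2%N * h 1%N 3%N + g 0%N 3%N * h 1%N 2%N
  + g 1%N 2%N * h 0%N 3%N - g 1%N 3%N * h 0%N 2%N + g 2%N 3%N * h 0%N 1%N.
Proof.
rewrite (expand_det_row _ ord0) !big_ord_recl big_ord0 /cofactor !minor_natmx.
by rewrite !det_natmx33 !mxE /bump /= /g /h; ring.
Qed.

(** * Right multiplication by j and bilinear forms *)

Section QuaternionicFrames.
Variable C : numClosedFieldType.
Implicit Types (x y z k l : C) (u v w : 'cV[C]_4) (Q P : 'M[C]_4).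

(* [right_mulj] over an arbitrary [numClosedFieldType]. *)
Definition mulj v : 'cV[C]_4 :=
  \col_(i < 4) [:: - (v 1 0)^*; (v 0 0)^*; - (v 3 0)^*; (v 2 0)^*]`_i.

Lemma muljE v : (mulj v 0 0 = - (v 1 0)^*) * (mulj v 1 0 = (v 0 0)^*) *
  (mulj v 2 0 = - (v 3 0)^*) * (mulj v 3 0 = (v 2 0)^*).
Proof. by rewrite !mxE. Qed.

Lemma muljD u v : mulj (u + v) = mulj u + mulj v.
Proof. by apply: col4P; rewrite !mxE /= !rmorphD /= ?opprD. Qed.

Lemma muljZ x v : mulj (x *: v) = x^* *: mulj v.
Proof. by apply: col4P; rewrite !mxE /= !rmorphM /= ?mulrN. Qed.

Lemma muljN v : mulj (- v) = - mulj v.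
Proof. by rewrite -scaleN1r muljZ rmorphN1 scaleN1r. Qed.

Lemma muljK v : mulj (mulj v) = - v.
Proof. by apply: col4P; rewrite !mxE /= ?rmorphN /= ?conjCK ?opprK. Qed.

Lemma mulj0 : mulj 0 = 0.
Proof. by have := muljZ 0 0; rewrite conjC0 !scale0r. Qed.

Lemma mulj_eq0 v : (mulj v == 0) = (v == 0).
Proof.
apply/eqP/eqP => [sv0|->]; last exact: mulj0.
by apply: oppr_inj; rewrite -muljK sv0 mulj0 oppr0.
Qed.

Definition bil Q v w : C := (v^T *m Q *m w) 0 0.

Lemma bilDl Q u v w : bil Q (u + v) w = bil Q u w + bil Q v w.
Proof. by rewrite /bil linearD !mulmxDl mxE. Qed.

Lemma bilDr Q u v w : bil Q u (v + w) = bil Q u v + bil Q u w.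
Proof. by rewrite /bil mulmxDr mxE. Qed.

Lemma bilZl Q x v w : bil Q (x *: v) w = x * bil Q v w.
Proof. by rewrite /bil linearZ -!scalemxAl mxE. Qed.

Lemma bilZr Q x v w : bil Q v (x *: w) = x * bil Q v w.
Proof. by rewrite /bil -scalemxAr mxE. Qed.

Lemma bilNl Q v w : bil Q (- v) w = - bil Q v w.
Proof. by rewrite -scaleN1r bilZl mulN1r. Qed.

Lemma bilNr Q v w : bil Q v (- w) = - bil Q v w.
Proof. by rewrite -scaleN1r bilZr mulN1r. Qed.

Lemma bil0l Q w : bil Q 0 w = 0.
Proof. by rewrite /bil trmx0 !mul0mx mxE. Qed.

Lemma bil0r Q v : bil Q v 0 = 0.
Proof. by rewrite /bil mulmx0 mxE. Qed.

Lemma bil_scale Q x v w : bil (x *: Q) v w = x * bil Q v w.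
Proof. by rewrite /bil -scalemxAr -scalemxAl mxE. Qed.

Lemma bil_add Q Q' v w : bil (Q + Q') v w = bil Q v w + bil Q' v w.
Proof. by rewrite /bil mulmxDr mulmxDl mxE. Qed.

Lemma bilC Q v w : Q^T = Q -> bil Q v w = bil Q w v.
Proof.
move=> symQ; rewrite /bil.
have -> : v^T *m Q *m w = (w^T *m Q *m v)^T.
  by rewrite !trmx_mul trmxK symQ mulmxA.
by rewrite mxE.
Qed.

Definition bilE := (muljD, muljN, muljZ, muljK, bilDl, bilDr, bilNl, bilNr, bilZl, bilZr).

(** Multiplying the relation by the conjugate quaternion leaves the norm [|x|^2 + |y|^2] times
    [v]. *)
Lemma quaternionic_span_free v x y :
  v != 0 -> x *: v + y *: mulj v = 0 -> x = 0 /\ y = 0.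
Proof.
move=> v0 e.
have e' : x^* *: mulj v - y^* *: v = 0.
  by rewrite -[RHS]mulj0 -e muljD !muljZ muljK scalerN.
have : (x * x^* + y * y^*) *: v = 0.
  transitivity (x^* *: (x *: v + y *: mulj v) - y *: (x^* *: mulj v - y^* *: v)).
    by apply/colP => i; rewrite !mxE /=; ring.
  by rewrite e e' !scaler0 subr0.
move/eqP; rewrite scaler_eq0 (negPf v0) orbF paddr_eq0 ?mul_conjC_ge0 //.
by rewrite !mul_conjC_eq0 => /andP[/eqP -> /eqP ->].
Qed.

(* For real [x] the equation reads [c (x^2 - |y|^2) = x (a conj y - d y)]; the
   phase of [y] is chosen to make [(a conj y - d y) / c] real. *)
Lemma exists_bil_mulj_eq0 Q w : Q^T = Q ->
  exists x y, (x != 0) || (y != 0) /\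
    bil Q (x *: w + y *: mulj w) (mulj (x *: w + y *: mulj w)) = 0.
Proof.
move=> symQ.
pose a := bil Q w w; pose c := bil Q w (mulj w).
pose d := bil Q (mulj w) (mulj w).
have bE x y : bil Q (x *: w + y *: mulj w) (mulj (x *: w + y *: mulj w)) =
    (x * x^* - y * y^*) * c - x * y^* * a + y * x^* * d.
  by rewrite !bilE (bilC (mulj w) w symQ) -/a -/c -/d; ring.
have [c0|c0] := eqVneq c 0.
  by exists 1, 0; rewrite oner_eq0 bE c0 conjC0; split=> //; ring.
(* Up to sign, this product differs from the [r] below by twice the real part of
   [conj (a / c) * z]. *)
have [z z0 zreal] : exists2 z : C, z != 0 & (d / c + (a / c)^*) * z \is Num.real.
  have [g0|g0] := eqVneq (d / c + (a / c)^*) 0.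
    by exists 1; rewrite ?oner_eq0 // g0 mul0r rpred0.
  exists (d / c + (a / c)^*)^*; first by rewrite conjC_eq0.
  exact/ger0_real/mul_conjC_ge0.
pose r := a / c * z^* - d / c * z.
have rreal : r \is Num.real.
  have -> : r = ((a / c)^* * z + ((a / c)^* * z)^*) -
      (d / c + (a / c)^*) * z by rewrite [((a / c)^* * z)^*]rmorphM /= conjCK /r; ring.
  by rewrite rpredB // CrealE rmorphD /= conjCK addrC.
pose s := sqrtC (r ^+ 2 + 4 * (z * z^*)).
have sreal : s \is Num.real.
  apply/ger0_real; rewrite sqrtC_ge0.
  apply: addr_ge0; first by rewrite real_exprn_even_ge0.
  by rewrite mulr_ge0 ?mul_conjC_ge0 ?ler0n.
(* A root of [X^2 - r X - |z|^2], real because the discriminant [s^2] is nonnegative. *)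
pose x := (r + s) / 2.
have xreal : x^* = x.
  by apply/CrealP/realM; [exact: realD | rewrite realV realn].
exists x, z; split; first by rewrite z0 orbT.
rewrite bE xreal.
have -> : (x * x - z * z^*) * c - x * z^* * a + z * x * d =
    c * (x * x - z * z^* - x * r) by rewrite /r; field.
suff -> : x * x - z * z^* - x * r = 0 by rewrite mulr0.
transitivity ((s ^+ 2 - (r ^+ 2 + 4 * (z * z^*))) / 4); first by rewrite /x; field.
by rewrite sqrtCK subrr mul0r.
Qed.

(** * Quaternionic frames and congruence *)

Definition frame v w : 'M[C]_4 :=
  \matrix_(i, j) [:: v; mulj v; w; mulj w]`_j i 0.

Lemma frame_mul v w (c : 'cV[C]_4) : frame v w *m c =
  c 0 0 *: v + c 1 0 *: mulj v + c 2 0 *: w + c 3 0 *: mulj w.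
Proof.
by apply/colP => i; rewrite !mxE sum_ord4 !mxE /=; ring.
Qed.

(** [frame v w] represents the right H-linear map sending the standard basis of H^2 to [v], [w]. *)
Lemma frame_mulj v w (c : 'cV[C]_4) :
  frame v w *m mulj c = mulj (frame v w *m c).
Proof.
rewrite !frame_mul !muljE !muljD !muljZ !muljK.
by rewrite !scalerN !scaleNr [- _ + _]addrC -!addrA; congr (_ + (_ + _));
  rewrite addrC.
Qed.

Lemma frame_gram Q v w i j : ((frame v w)^T *m Q *m frame v w) i j =
  bil Q ([:: v; mulj v; w; mulj w]`_i) ([:: v; mulj v; w; mulj w]`_j).
Proof.
rewrite /bil !mxE; apply: eq_bigr => k _; rewrite !mxE; congr (_ * _).
by apply: eq_bigr => l _; rewrite !mxE.
Qed.

Definition quaternionic P := forall c : 'cV[C]_4, P *m mulj c = mulj (P *m c).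

(** The scalar [c] is allowed because a quadric determines its form only up to scale. The
    determinant of [P] is normalized later. *)
Definition congruent Q Q' := exists P c,
  [/\ quaternionic P, P \in unitmx, c != 0 & Q' = c *: (P^T *m Q *m P)].

Lemma frame_gram_eq Q N v w : Q^T = Q -> N^T = N ->
    bil Q v v = N 0 0 -> bil Q v (mulj v) = N 0 1 ->
    bil Q (mulj v) (mulj v) = N 1 1 ->
    bil Q v w = N 0 2 -> bil Q v (mulj w) = N 0 3 ->
    bil Q (mulj v) w = N 1 2 -> bil Q (mulj v) (mulj w) = N 1 3 ->
    bil Q w w = N 2 2 -> bil Q w (mulj w) = N 2 3 ->
    bil Q (mulj w) (mulj w) = N 3 3 ->
  (frame v w)^T *m Q *m frame v w = N.
Proof.
move=> symQ symN *; have symNE i j : N i j = N j i by rewrite -[N in LHS]symN mxE.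
apply/matrixP => i j; rewrite frame_gram.
by case: (ord4P i) => ->; case: (ord4P j) => -> //=; rewrite bilC // symNE.
Qed.

Definition diag4 x y z t : 'M[C]_4 := diag_mx (\row_i [:: x; y; z; t]`_i).

Lemma det_diag4 x y z t : \det (diag4 x y z t) = x * y * z * t.
Proof.
rewrite det_diag !big_ord_recl big_ord0 !mxE /=; ring.
Qed.

(** Two linear conditions on a space of dimension four have a nonzero common solution. *)
Lemma exists_orthogonal_pair Q u v :
  exists w, [/\ w != 0, bil Q u w = 0 & bil Q v w = 0].
Proof.
pose A := row_mx (Q^T *m u) (Q^T *m v).
have : kermx A != 0.
  rewrite kermx_eq0 /row_free neq_ltn; apply/orP; left.
  exact: leq_ltn_trans (rank_leq_col A) _.
move=> kA0; pose r := nz_row (kermx A).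
have : r *m A = 0 by apply/sub_kermxP/nz_row_sub.
rewrite mul_mx_row -(row_mx0 _ 1 1 1) => /eq_row_mx[ru rv].
have bilE0 (z : 'cV[C]_4) : r *m (Q^T *m z) = 0 -> bil Q z r^T = 0.
  move=> rz; rewrite /bil; suff -> : z^T *m Q *m r^T = 0 by rewrite mxE.
  by apply: trmx_inj; rewrite !trmx_mul !trmxK trmx0.
exists r^T; split; [|exact: bilE0..].
by rewrite -(inj_eq (@trmx_inj _ _ _)) trmxK trmx0 nz_row_eq0.
Qed.

(** Pairing a linear relation with [v] and [mulj v] kills its first two coefficients; the rest is a
    relation inside [wH]. *)
Lemma orthogonal_frame_unit Q v w : Q^T = Q -> v != 0 -> w != 0 ->
    bil Q v v != 0 -> bil Q v (mulj v) = 0 -> bil Q (mulj v) (mulj v) != 0 ->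
    bil Q v w = 0 -> bil Q v (mulj w) = 0 ->
    bil Q (mulj v) w = 0 -> bil Q (mulj v) (mulj w) = 0 ->
  frame v w \in unitmx.
Proof.
move=> symQ v0 w0 vv vjv jvjv vw vjw jvw jvjw.
rewrite -unitmx_tr unitmxE unitfE; apply/negP => /det0P[r r0].
move=> /(congr1 trmx); rewrite trmx_mul trmxK trmx0 frame_mul => e.
have e1 : r^T 0 0 = 0.
  have := congr1 (bil Q v) e; rewrite !bilE vjv vw vjw !mulr0 !addr0.
  rewrite bil0r => /eqP.
  by rewrite mulf_eq0 (negPf vv) orbF => /eqP.
have e2 : r^T 1 0 = 0.
  have := congr1 (bil Q (mulj v)) e.
  rewrite !bilE (bilC (mulj v) v symQ) vjv jvw jvjw !mulr0 !addr0 add0r.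
  rewrite bil0r => /eqP.
  by rewrite mulf_eq0 (negPf jvjv) orbF => /eqP.
move: e; rewrite e1 e2 !scale0r !add0r => /(quaternionic_span_free w0)[e3 e4].
case/eqP: r0; apply: trmx_inj; rewrite trmx0.
by apply: col4P; rewrite ?e1 ?e2 ?e3 ?e4 mxE.
Qed.

(** The last hypothesis makes the orthogonal complement of [vH] stable under j, so within it the
    second frame vector can be chosen orthogonal to its own image under j. *)
Lemma frame_diagonal Q v : Q^T = Q -> Q \in unitmx ->
    bil Q v v != 0 -> bil Q v (mulj v) = 0 -> bil Q (mulj v) (mulj v) != 0 ->
    (forall u, bil Q v u = 0 -> bil Q (mulj v) u = 0 ->
       bil Q v (mulj u) = 0 /\ bil Q (mulj v) (mulj u) = 0) ->
  exists x y z t, x * y * z * t != 0 /\ congruent Q (diag4 x y z t).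
Proof.
move=> symQ uQ vv vjv jvjv perp.
have v0 : v != 0 by apply: contraNneq vv => ->; rewrite bil0l.
have [w [w0 vw jvw]] := exists_orthogonal_pair Q v (mulj v).
have [vjw jvjw] := perp w vw jvw.
have [x [y [xy]]] := exists_bil_mulj_eq0 w symQ.
set u := x *: w + y *: mulj w => ujk.
have u0 : u != 0.
  apply: contraTneq xy => /(quaternionic_span_free w0)[-> ->].
  by rewrite eqxx.
have vu : bil Q v u = 0 by rewrite !bilE vw vjw !mulr0 addr0.
have jvu : bil Q (mulj v) u = 0 by rewrite !bilE jvw jvjw !mulr0 addr0.
have [vju jvju] := perp u vu jvu.
have uP := orthogonal_frame_unit symQ v0 u0 vv vjv jvjv vu vju jvu jvju.
have gram : (frame v u)^T *m Q *m frame v u = diag4 (bil Q v v)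
    (bil Q (mulj v) (mulj v)) (bil Q u u) (bil Q (mulj u) (mulj u)).
  by apply: frame_gram_eq; rewrite ?tr_diag_mx // !mxE.
do 4!eexists; split; last first.
  exists (frame v u), 1; split; rewrite ?oner_eq0 ?scale1r ?gram //.
  exact: frame_mulj.
rewrite -det_diag4 -gram !det_mulmx det_tr !mulf_neq0 -?unitfE -?unitmxE //.
Qed.

(** * Eigenvectors and their eigenvalues *)

(* [v] is an eigenvector of [Q^-1 Q'] with eigenvalue [conj l], where
   [Q'(v, u) = conj Q(vj, uj)]. *)
Definition eigenj Q l v :=
  forall u, bil Q (mulj v) (mulj u) = l * (bil Q v u)^*.

Lemma bil_nondegenerate Q v :
  Q \in unitmx -> (forall u, bil Q v u = 0) -> v = 0.
Proof.
move=> uQ v0; have : v^T *m Q = 0.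
  apply/rowP => j; have := v0 (delta_mx j 0).
  by rewrite /bil -colE !mxE.
move/(congr1 (mulmx^~ (invmx Q))); rewrite mulmxK // mul0mx => /(congr1 trmx).
by rewrite trmxK trmx0.
Qed.

Lemma exists_eigenj Q : Q \in unitmx -> exists l v, v != 0 /\ eigenj Q l v.
Proof.
move=> uQ.
(* Rows stop at their last nonzero entry; the default value of [nth] supplies the zeros. *)
pose J : 'M[C]_4 := \matrix_(i, j)
  (nth [::] [:: [:: 0; -1]; [:: 1]; [:: 0; 0; 0; -1]; [:: 0; 0; 1]] i)`_j.
have JE v : mulj v = J *m map_mx Num.conj v.
  by apply: col4P; rewrite !mxE sum_ord4 !mxE /=; ring.
pose Q' := map_mx Num.conj (J^T *m Q *m J).
have Q'E v u : (v^T *m Q' *m u) 0 0 = (bil Q (mulj v) (mulj u))^*.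
  have conjK m n (A : 'M[C]_(m, n)) : map_mx Num.conj (map_mx Num.conj A) = A.
    by apply/matrixP => i j; rewrite !mxE conjCK.
  rewrite /bil !JE.
  transitivity (map_mx Num.conj ((J *m map_mx Num.conj v)^T *m Q *m
    (J *m map_mx Num.conj u)) 0 0); last by rewrite mxE.
  by rewrite /Q' trmx_mul !map_mxM -!map_trmx !conjK !mulmxA.
(* Eigenvectors are rows here: [r Q' = a r Q]. Since [Q'] involves a conjugation, the eigenvalue
   becomes [conj a]. *)
have [//|a /eigenvalueP[r rE r0]] := @eigenvalue_closed C 4 (Q' *m invmx Q).
exists a^*, r^T; split.
  by rewrite -(inj_eq (@trmx_inj _ _ _)) trmxK trmx0.
move=> u; apply: (can_inj conjCK); rewrite rmorphM /= !conjCK -Q'E /bil trmxK.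
have -> : r *m Q' = a *: r *m Q by rewrite -rE mulmxA mulmxKV.
by rewrite -!scalemxAl mxE.
Qed.

(** The eigenvector relation at [mulj u], with [j^2 = -1]. It yields the stability under j of the
    complement of [vH]. *)
Lemma eigenj_perp Q l v u : l != 0 -> eigenj Q l v ->
  bil Q v (mulj u) = - (l^*)^-1 * (bil Q (mulj v) u)^*.
Proof.
move=> l0 /(_ (mulj u)); rewrite muljK bilNr => /(congr1 Num.conj).
rewrite rmorphM rmorphN /= conjCK mulNr -mulrN => ->.
by rewrite mulKf ?conjC_eq0.
Qed.

(** Eigenvalues thus pair up under inversion in the unit circle, and one of each pair has modulus at
    least 1. *)
Lemma eigenj_mulj Q l v : l != 0 -> eigenj Q l v -> eigenj Q (l^*)^-1 (mulj v).
Proof.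
by move=> l0 ev u; rewrite muljK bilNl (eigenj_perp _ l0 ev) mulNr opprK.
Qed.

Lemma eigenj_neq0 Q l v : Q \in unitmx -> v != 0 -> eigenj Q l v -> l != 0.
Proof.
move=> uQ v0 ev; apply: contraNneq v0 => l0; rewrite -mulj_eq0; apply/eqP.
apply: (bil_nondegenerate uQ) => u.
by rewrite -[u]opprK -muljK ev l0 mul0r.
Qed.

(** As [x / conj x] has modulus one, only the phase of the eigenvalue changes. *)
Lemma eigenj_scale Q l v x : x != 0 ->
  eigenj Q l v -> eigenj (x *: Q) (x / x^* * l) v.
Proof.
move=> x0 ev u; have xc0 : x^* != 0 by rewrite conjC_eq0.
by rewrite !bil_scale rmorphM ev /=; field.
Qed.

Lemma eigenjZ Q l v x : eigenj Q l v -> eigenj Q l (x *: v).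
Proof. by move=> ev u; rewrite !bilE ev rmorphM mulrCA. Qed.

Lemma eigenjD Q l v w : eigenj Q l v -> eigenj Q l w -> eigenj Q l (v + w).
Proof. by move=> ev ew u; rewrite !bilE ev ew rmorphD mulrDr. Qed.

Lemma congruent_scale Q Q' x :
  x != 0 -> congruent (x *: Q) Q' -> congruent Q Q'.
Proof.
move=> x0 [P [c [qP uP c0 ->]]]; exists P, (c * x); split=> //.
  by rewrite mulf_neq0.
by rewrite -scalemxAr -scalemxAl scalerA.
Qed.

Lemma congruent_frame Q N v w : \det N != 0 ->
  (frame v w)^T *m Q *m frame v w = N -> congruent Q N.
Proof.
move=> N0 QN; exists (frame v w), 1; split; rewrite ?oner_eq0 ?scale1r //.
  exact: frame_mulj.
rewrite unitmxE unitfE; apply: contraNneq N0 => P0.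
by rewrite -QN !det_mulmx P0 mulr0.
Qed.

Lemma exists_eigenj_ge1 Q : Q^T = Q -> Q \in unitmx -> exists x l v,
  [/\ x != 0, v != 0, 1 <= l, eigenj (x *: Q) l v & bil (x *: Q) v (mulj v) = 0].
Proof.
move=> symQ uQ; have [l [v [v0 ev]]] := exists_eigenj uQ.
have l0 := eigenj_neq0 uQ v0 ev.
(* Then [x / conj x = x^2 / |x|^2 = conj l / |l|], which turns the eigenvalue into [|l|]. *)
pose x := sqrtC l^*.
have x0 : x != 0 by rewrite sqrtC_eq0 conjC_eq0.
have symxQ : (x *: Q)^T = x *: Q by rewrite linearZ /= symQ.
have xl : x / x^* * l = `|l|.
  have -> : x / x^* = x ^+ 2 / `|x| ^+ 2.
    by rewrite normCK; field; rewrite x0 conjC_eq0 x0.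
  rewrite sqrtCK -normrX sqrtCK norm_conjC mulrAC [_ * l]mulrC -normCK.
  by rewrite expr2 mulfK ?normr_eq0.
have [m [w [w0 m1 ew]]] : exists m w, [/\ w != 0, 1 <= m & eigenj (x *: Q) m w].
  have := eigenj_scale x0 ev; rewrite xl => exv.
  have [l1|l1] := real_leP (ger0_real ler01) (ger0_real (normr_ge0 l)).
    by exists `|l|, v.
  exists (`|l|^*)^-1, (mulj v); split; first by rewrite mulj_eq0.
    by rewrite conj_normC invf_ge1 ?normr_gt0 // ltW.
  by apply: eigenj_mulj; rewrite ?normr_eq0.
have m0 : m != 0 by apply: contraTneq m1 => ->; rewrite ler10.
have mr : m^* = m by apply/geC0_conj/(le_trans ler01).
(* If [m = 1], then [mulj w] has the same eigenvalue and any vector of [wH] may be taken. *)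
have [m_eq1|m_neq1] := eqVneq m 1.
  have [y [z [yz bil0]]] := exists_bil_mulj_eq0 w symxQ.
  exists x, m, (y *: w + z *: mulj w); split=> //.
    apply: contraTneq yz => /(quaternionic_span_free w0)[-> ->].
    by rewrite eqxx.
  apply: eigenjD; apply: eigenjZ => //.
  by have := eigenj_mulj m0 ew; rewrite mr m_eq1 invr1.
exists x, m, w; split=> //.
(* Taking norms in the relation at [mulj w] gives [|b| = m |b|] for [b = bil (x *: Q) w (mulj w)],
   so [b = 0]. *)
have := ew (mulj w); rewrite muljK bilNr bilC // => /(congr1 Num.norm).
rewrite normrN normrM norm_conjC => /eqP.
rewrite (ger0_norm (le_trans ler01 m1)) -[X in X == _]mul1r.
rewrite -subr_eq0 -mulrBl mulf_eq0 subr_eq0 eq_sym (negPf m_neq1) normr_eq0.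
by move/eqP.
Qed.

(** * Isotropic eigenlines and the normal form of matrices *)

(* [w = Q^-1 (conj v) / |v|^2] works, as [vj] is Hermitian-orthogonal to [v]. *)
Lemma exists_dual Q v : Q \in unitmx -> v != 0 ->
  exists w, bil Q v w = 1 /\ bil Q (mulj v) w = 0.
Proof.
move=> uQ v0; pose vc := map_mx Num.conj v.
pose n := (v^T *m vc) 0 0.
have nE : n = \sum_i v i 0 * (v i 0)^*.
  by rewrite /n mxE; apply: eq_bigr => i _; rewrite !mxE.
have n0 : n != 0.
  apply: contraNneq v0; rewrite nE => /psumr_eq0P e; apply/eqP/colP => i.
  have /eqP := e (fun i _ => mul_conjC_ge0 _) i isT.
  by rewrite mul_conjC_eq0 mxE => /eqP.
exists (n^-1 *: (invmx Q *m vc)); rewrite !bilZr /bil !mulmxA.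
rewrite !(mulmxK uQ) -/n mulVf //; split=> //.
rewrite [X in _ * X]mxE sum_ord4 !mxE /=; apply/eqP.
rewrite mulf_eq0; apply/orP; right; apply/eqP; ring.
Qed.

(* The exceptional form with [l = (1 + k) / (1 - k)], in the frame
   [e1 + e2, e2 - e1, (e3 - e4) / (1 - k), (e3 + e4) / (1 - k)] adapted to the
   eigenlines. *)
Definition twistor_mx l : 'M[C]_4 := natmx 4 4 (fun i j =>
  (nth [::] [:: [:: 2 * 'i; 0; 1; 0]; [:: 0; 2 * 'i; 0; l]; [:: 1]; [:: 0; l]] i)`_j).

Lemma tr_twistor_mx l : (twistor_mx l)^T = twistor_mx l.
Proof.
apply/matrixP => i j; rewrite !mxE.
by case: (ord4P i) => ->; case: (ord4P j) => ->.
Qed.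

Lemma det_twistor_mx l : \det (twistor_mx l) = l ^+ 2.
Proof. by rewrite det_natmx44 /=; ring. Qed.

(* If [l > 1], adding a multiple of [vj] to [w] cancels [bil Q w (mulj w)].  If
   [l = 1] this can fail, but all of [vH] consists of eigenvectors, so [w] may be
   moved within [wH] and [v] recomputed by duality. *)
Lemma exists_hyperbolic_frame Q l v : Q^T = Q -> Q \in unitmx -> v != 0 ->
    1 <= l -> eigenj Q l v -> bil Q v v = 0 -> bil Q v (mulj v) = 0 ->
  exists v w, [/\ eigenj Q l v, bil Q v v = 0 /\ bil Q v (mulj v) = 0,
    bil Q v w = 1, bil Q (mulj v) w = 0 & bil Q w (mulj w) = 0].
Proof.
move=> symQ uQ v0 l1 ev vv vjv.
have l0 : l != 0 by apply: contraTneq l1 => ->; rewrite ler10.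
have lr : l^* = l by apply/geC0_conj/(le_trans ler01).
have [w [vw jvw]] := exists_dual uQ v0.
have vjw : bil Q v (mulj w) = 0.
  by rewrite (eigenj_perp _ l0 ev) jvw conjC0 mulr0.
have jvjw : bil Q (mulj v) (mulj w) = l by rewrite ev vw conjC1 mulr1.
have [l_eq1|l_neq1] := eqVneq l 1.
  have [x [y [xy wjw]]] := exists_bil_mulj_eq0 w symQ.
  pose n := x * x^* + y * y^*.
  have n0 : n != 0.
    by rewrite paddr_eq0 ?mul_conjC_ge0 // !mul_conjC_eq0 negb_and.
  have jvjv : bil Q (mulj v) (mulj v) = 0 by rewrite ev vv conjC0 mulr0.
  (* Dividing by the norm [n] of the quaternion applied to [w] restores the pairing to 1. *)
  exists ((x^* / n) *: v + (y^* / n) *: mulj v), (x *: w + y *: mulj w).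
  have nr : n^* = n by rewrite rmorphD !rmorphM /= !conjCK ![_^* * _]mulrC.
  have nE : n = x * x^* + y * y^* by [].
  split=> //.
  - apply: eigenjD; apply: eigenjZ => //.
    by have := eigenj_mulj l0 ev; rewrite lr l_eq1 invr1.
  - by rewrite !bilE (bilC (mulj v) v symQ) vv vjv jvjv; split; ring.
  - by rewrite !bilE vw vjw jvw jvjw l_eq1 nE; field; rewrite -nE.
  - rewrite !bilE vw vjw jvw jvjw l_eq1 !rmorphM !fmorphV /= !conjCK nr.
    by field.
pose c := bil Q w (mulj w).
(* Solves [c - conj y + l y = 0], the vanishing of the form on [w + y vj] and its image under j. *)
pose y := (l * c + c^*) / (1 - l ^+ 2).
have l2 : 1 - l ^+ 2 != 0.
  rewrite subr_eq0 eq_sym -subr_eq0 subr_sqr_1 mulf_neq0 ?subr_eq0 //.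
  by rewrite paddr_eq0 ?oner_eq0 ?andbF // (le_trans ler01).
exists v, (w + y *: mulj v); split=> //.
- by rewrite !bilE vw vjv mulr0 addr0.
- by rewrite !bilE jvw ev vv conjC0 !mulr0 addr0.
have yc : y^* = (l * c^* + c) / (1 - l ^+ 2).
  by rewrite rmorphM fmorphV rmorphB rmorphD rmorphM rmorphXn /= lr conjCK conjC1.
rewrite !bilE (bilC w v symQ) vw jvjw (bilC (mulj v) v symQ) vjv yc -/c /y.
by field.
Qed.

Lemma isotropic_normal_form Q l v : Q^T = Q -> Q \in unitmx -> v != 0 ->
    1 <= l -> eigenj Q l v -> bil Q v v = 0 -> bil Q v (mulj v) = 0 ->
  (exists x y z t, x * y * z * t != 0 /\ congruent Q (diag4 x y z t)) \/
  congruent Q (twistor_mx l).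
Proof.
move=> symQ uQ v0 l1 ev vv vjv.
have l0 : l != 0 by apply: contraTneq l1 => ->; rewrite ler10.
have lr : l^* = l by apply/geC0_conj/(le_trans ler01).
have [{v0 ev vv vjv} v [w [ev [vv vjv] vw jvw wjw]]] :=
  exists_hyperbolic_frame symQ uQ v0 l1 ev vv vjv.
have vjw : bil Q v (mulj w) = 0.
  by rewrite (eigenj_perp _ l0 ev) jvw conjC0 mulr0.
have jvjw : bil Q (mulj v) (mulj w) = l by rewrite ev vw conjC1 mulr1.
have jvjv : bil Q (mulj v) (mulj v) = 0 by rewrite ev vv conjC0 mulr0.
have [wv [wjv [jwv jwjv]]] : bil Q w v = 1 /\ bil Q w (mulj v) = 0 /\
    bil Q (mulj w) v = 0 /\ bil Q (mulj w) (mulj v) = l.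
  by rewrite !(bilC _ v symQ) !(bilC _ (mulj v) symQ).
have jvv : bil Q (mulj v) v = 0 by rewrite bilC.
have jww : bil Q (mulj w) w = 0 by rewrite bilC.
(* Put [w0 = w - (a / 2) v]. This vector is isotropic, and [f] is the value of the form on [mulj w0]
   twice. *)
pose a := bil Q w w; pose f := bil Q (mulj w) (mulj w) - l * a^*.
have jwjwE : bil Q (mulj w) (mulj w) = f + l * a^* by rewrite /f subrK.
pose bE := (wv, wjv, jwv, jwjv, vv, vjv, jvv, jvjv, vw, vjw, jvw, jvjw, wjw, jww,
  jwjwE, erefl : bil Q w w = a).
have [f0|f0] := eqVneq f 0.
  left; exists 2, (2 * l), (- 2), (- (2 * l)); split.
    by rewrite !(mulf_neq0, oppr_eq0) ?pnatr_eq0.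
  (* These are [w0 + v] and [w0 - v]; with [f = 0] the lines [vH] and [w0H] are both isotropic. *)
  apply: (@congruent_frame _ _ (w + (1 - a / 2) *: v) (w - (1 + a / 2) *: v)).
    by rewrite det_diag4 !(mulf_neq0, oppr_eq0) ?pnatr_eq0.
  by apply: frame_gram_eq; rewrite ?tr_diag_mx // !mxE ?mulr1n ?mulr0n /=
    !bilE !bE ?f0 ?(rmorphD, rmorphB, rmorphM, fmorphV, rmorphN, conjC1, conjC_nat) /=; field.
right.
(* Replacing [w], [v] by [t w], [v / t] keeps their pairing and multiplies [f] by [(conj t)^2]. The
   new value [2i(1 + l)] is what makes the second diagonal entry [2i]. *)
pose t := sqrtC (2 * 'i * (1 + l) / f)^*.
have l10 : 1 + l != 0.
  by rewrite paddr_eq0 ?oner_eq0 // (le_trans ler01).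
have t0 : t != 0.
  rewrite sqrtC_eq0 conjC_eq0 !mulf_neq0 ?invr_eq0 ?pnatr_eq0 //.
  exact: neq0Ci.
have tf : t^* * t^* * f = 2 * 'i * (1 + l).
  by rewrite -expr2 -rmorphXn /= sqrtCK conjCK divfK.
have tc0 : t^* != 0 by rewrite conjC_eq0.
(* Makes the first diagonal entry [t^2 a + 2 x] equal to [2i]. *)
pose x := 'i - t * t * a / 2.
apply: (@congruent_frame _ _ (t *: w + x *: (t^-1 *: v)) (t^-1 *: v)).
  by rewrite det_twistor_mx expf_neq0.
have xc : x^* = - 'i - t^* * t^* * a^* / 2.
  by rewrite rmorphB !rmorphM fmorphV /= conjCi conjC_nat.
apply: frame_gram_eq; rewrite ?tr_twistor_mx // !mxE /= !bilE !bE ?fmorphV /= ?xc /x;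
  try by field; rewrite ?t0 ?tc0.
transitivity (t^* * t^* * f - 2 * 'i * l); last by rewrite tf; ring.
by field.
Qed.

Lemma quaternionic_normal_form Q : Q^T = Q -> Q \in unitmx ->
  (exists x y z t, x * y * z * t != 0 /\ congruent Q (diag4 x y z t)) \/
  (exists2 l, 1 <= l & congruent Q (twistor_mx l)).
Proof.
move=> symQ uQ; have [x [l [v [x0 v0 l1 ev vjv]]]] := exists_eigenj_ge1 symQ uQ.
have symxQ : (x *: Q)^T = x *: Q by rewrite linearZ /= symQ.
have uxQ : x *: Q \in unitmx.
  by rewrite unitmxE detZ unitfE mulf_neq0 ?expf_neq0 // -unitfE -unitmxE.
have l0 : l != 0 by apply: contraTneq l1 => ->; rewrite ler10.
suff : (exists x' y z t, x' * y * z * t != 0 /\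
    congruent (x *: Q) (diag4 x' y z t)) \/ congruent (x *: Q) (twistor_mx l).
  case=> [[x' [y [z [t [nz]]]]]|] /(congruent_scale x0) cQ.
    by left; exists x', y, z, t.
  by right; exists l.
have [vv|vv] := eqVneq (bil (x *: Q) v v) 0.
  exact: (isotropic_normal_form symxQ uxQ v0).
left; apply: (frame_diagonal symxQ uxQ vv vjv).
  by rewrite ev mulf_neq0 ?conjC_eq0.
move=> u vu jvu; rewrite ev vu (eigenj_perp _ l0 ev) jvu conjC0.
by rewrite !mulr0.
Qed.

(** * Determinants of quaternionic matrices *)

Lemma quaternionic_frame P : quaternionic P -> P = frame (col 0 P) (col 2 P).
Proof.
move=> qP.
have e0 : mulj (delta_mx 0 0 : 'cV[C]_4) = delta_mx 1 0.
  by apply: col4P; rewrite !mxE /= ?conjC1 ?conjC0 ?oppr0.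
have e2 : mulj (delta_mx 2 0 : 'cV[C]_4) = delta_mx 3 0.
  by apply: col4P; rewrite !mxE /= ?conjC1 ?conjC0 ?oppr0.
have c1 : col 1 P = mulj (col 0 P) by rewrite !colE -e0 qP.
have c3 : col 3 P = mulj (col 2 P) by rewrite !colE -e2 qP.
apply/matrixP => i j; rewrite [RHS]mxE.
by case: (ord4P j) => -> /=; rewrite -?c1 -?c3 mxE.
Qed.

(* For [frame v w] = [[a, b], [c, d]] as a 2x2 matrix of quaternions and [N] the
   reduced norm, block elimination gives
   [N a * det = N (N a * d - c * conj a * b)]. *)
Lemma det_frame_ge0 v w : 0 <= \det (frame v w).
Proof.
pose a i := v i 0; pose b i := w i 0.
have -> : \det (frame v w) = \det (natmx 4 4 (fun i j => (nth [::]
    [:: [:: a 0; - (a 1)^*; b 0; - (b 1)^*]; [:: a 1; (a 0)^*; b 1; (b 0)^*];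
        [:: a 2; - (a 3)^*; b 2; - (b 3)^*]; [:: a 3; (a 2)^*; b 3; (b 2)^*]] i)`_j)).
  congr determinant; apply/matrixP => i j; rewrite !mxE.
  by case: (ord4P i) => ->; case: (ord4P j) => -> //=; rewrite !mxE.
rewrite det_natmx44 /=.
pose n := a 0 * (a 0)^* + a 1 * (a 1)^*.
have n_ge0 : 0 <= n by rewrite addr_ge0 ?mul_conjC_ge0.
have [n0|n0] := eqVneq n 0.
  move/eqP: n0; rewrite paddr_eq0 ?mul_conjC_ge0 // !mul_conjC_eq0.
  case/andP=> /eqP a0 /eqP a1.
  have : 0 <= (a 2 * (a 2)^* + a 3 * (a 3)^*) * (b 0 * (b 0)^* + b 1 * (b 1)^*).
    by rewrite mulr_ge0 ?addr_ge0 ?mul_conjC_ge0.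
  by congr (0 <= _); rewrite a0 a1 conjC0; ring.
have n_gt0 : 0 < n by rewrite lt_def n0.
(* In quaternions, [p + j q] is [conj a * b], and [e + j f] below is [N a * d - c * conj a * b]. *)
pose p := (a 0)^* * b 0 + (a 1)^* * b 1.
pose q := a 0 * b 1 - a 1 * b 0.
have pc : p^* = a 0 * (b 0)^* + a 1 * (b 1)^*.
  by rewrite rmorphD !rmorphM /= !conjCK.
have qc : q^* = (a 0)^* * (b 1)^* - (a 1)^* * (b 0)^*.
  by rewrite rmorphB !rmorphM.
pose e := n * b 2 - (a 2 * p - (a 3)^* * q).
pose f := n * b 3 - (a 3 * p + (a 2)^* * q).
have nc : n^* = n by apply: geC0_conj.
have [nE pE qE] : [/\ n = a 0 * (a 0)^* + a 1 * (a 1)^*,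
  p = (a 0)^* * b 0 + (a 1)^* * b 1 & q = a 0 * b 1 - a 1 * b 0] by [].
clearbody n p q.
have ec : e^* = n * (b 2)^* - ((a 2)^* * p^* - a 3 * q^*).
  by rewrite rmorphB rmorphM rmorphB !rmorphM /= conjCK nc.
have fc : f^* = n * (b 3)^* - ((a 3)^* * p^* + a 2 * q^*).
  by rewrite rmorphB rmorphM rmorphD !rmorphM /= conjCK nc.
rewrite -(pmulr_rge0 _ n_gt0).
have : 0 <= e * e^* + f * f^* by rewrite addr_ge0 ?mul_conjC_ge0.
congr (0 <= _); rewrite ec fc pc qc /e /f pE qE nE; ring.
Qed.

Lemma quaternionicZ P x : x^* = x -> quaternionic P -> quaternionic (x *: P).
Proof. by move=> xc qP c; rewrite -!scalemxAl qP muljZ xc. Qed.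

(** Scaling by a real number preserves commutation with j, and a positive determinant has a positive
    fourth root. *)
Lemma quaternionic_normalize P : quaternionic P -> P \in unitmx ->
  exists2 x, x != 0 & \det (x *: P) = 1 /\ quaternionic (x *: P).
Proof.
move=> qP uP; have dP : \det P != 0 by rewrite -unitfE -unitmxE.
have d_ge0 : 0 <= \det P by rewrite (quaternionic_frame qP) det_frame_ge0.
have r0 : 4.-root (\det P) != 0 by rewrite rootC_eq0.
exists (4.-root (\det P))^-1; first by rewrite invr_eq0.
split; first by rewrite detZ exprVn rootCK // mulVf.
by apply: quaternionicZ => //; apply: geC0_conj; rewrite invr_ge0 rootC_ge0.
Qed.

Lemma quaternionic_inv P : P \in unitmx -> quaternionic P -> quaternionic (invmx P).
Proof.
by move=> uP qP c; apply: (can_inj (mulKmx uP)); rewrite qP !mulKVmx.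
Qed.

(** * Congruences to the standard matrices *)

Lemma congruent_trans Q1 Q2 Q3 :
  congruent Q1 Q2 -> congruent Q2 Q3 -> congruent Q1 Q3.
Proof.
move=> [P [x [qP uP x0 ->]]] [P' [y [qP' uP' y0 ->]]].
exists (P *m P'), (y * x); split; rewrite ?mulf_neq0 ?unitmx_mul ?uP //.
  by move=> c; rewrite -!mulmxA qP' qP.
by rewrite -scalemxAr -scalemxAl scalerA trmx_mul !mulmxA.
Qed.

Lemma congruent_sym Q Q' : congruent Q Q' -> congruent Q' Q.
Proof.
move=> [P [x [qP uP x0 ->]]]; exists (invmx P), x^-1.
split; rewrite ?unitmx_inv ?invr_eq0 //; first exact: quaternionic_inv.
rewrite -scalemxAr -scalemxAl scalerA mulVf // scale1r trmx_inv.
by rewrite !mulmxA mulVmx ?unitmx_tr // mul1mx mulmxK.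
Qed.

Lemma bil_natmx (f : nat -> nat -> C) v w :
  bil (natmx 4 4 f) v w = \sum_(j < 4) (\sum_(i < 4) v i 0 * f i j) * w j 0.
Proof.
rewrite /bil mxE; apply: eq_bigr => j _; rewrite !mxE; congr (_ * _).
by apply: eq_bigr => i _; rewrite !mxE.
Qed.

Definition exceptional_mx k : 'M[C]_4 := natmx 4 4 (fun i j => (nth [::]
  [:: [:: 'i; 0; - k / 2; - 1 / 2]; [:: 0; 'i; 1 / 2; k / 2];
      [:: - k / 2; 1 / 2]; [:: - 1 / 2; k / 2]] i)`_j).

Lemma exceptional_mx_congruent k : 0 <= k < 1 ->
  congruent (exceptional_mx k) (twistor_mx ((1 + k) / (1 - k))).
Proof.
case/andP=> k_ge0 k_lt1; have kc : k^* = k by apply: geC0_conj.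
have k1 : 1 - k != 0 by rewrite subr_eq0 gt_eqF.
have k1' : 1 + k != 0.
  by rewrite paddr_eq0 ?oner_eq0 ?ler01.
pose v : 'cV[C]_4 := \col_i [:: 1; 1; 0; 0]`_i.
pose w : 'cV[C]_4 := (1 - k)^-1 *: \col_i [:: 0; 0; 1; -1]`_i.
have symE : (exceptional_mx k)^T = exceptional_mx k.
  by apply/matrixP => i j; rewrite !mxE; case: (ord4P i) => ->; case: (ord4P j) => ->.
apply: (@congruent_frame _ _ v w).
  by rewrite det_twistor_mx expf_neq0 // mulf_neq0 ?invr_eq0.
have k1c : (1 - k)^* = 1 - k by rewrite rmorphB /= conjC1 kc.
apply: frame_gram_eq; rewrite ?tr_twistor_mx // bil_natmx !sum_ord4 !mxE /=
  ?(rmorphM, rmorphN, fmorphV) /= ?k1c ?conjC1 ?conjC0; field => //.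
Qed.

(** Left multiplication by a complex [p] acts on the coordinates of [c1 + j c2] by [p] and
    [conj p]. *)
Lemma diag4_congruent x y z t a p q : a != 0 -> p != 0 -> q != 0 ->
  congruent (diag4 x y z t) (diag4 (a * p ^+ 2 * x) (a * p^* ^+ 2 * y)
    (a * q ^+ 2 * z) (a * q^* ^+ 2 * t)).
Proof.
move=> a0 p0 q0; pose P := frame (p *: delta_mx 0 0) (q *: delta_mx 2 0).
have PE : P = diag4 p p^* q q^*.
  apply/matrixP => i j; rewrite !mxE; case: (ord4P i) => ->; case: (ord4P j) => ->;
    by rewrite ?mxE /= ?mxE /= ?mulr1n ?mulr0n ?mulr1 ?mulr0 ?conjC0 ?oppr0.
exists P, a; split=> //; first exact: frame_mulj.
  by rewrite unitmxE PE det_diag4 unitfE !mulf_neq0 ?conjC_eq0.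
rewrite PE tr_diag_mx !mulmx_diag -linearZ /=; congr diag_mx.
by apply/rowP => i; rewrite !mxE; case: (ord4P i) => -> /=; ring.
Qed.

End QuaternionicFrames.

(** * From matrices to quadrics in projective space *)

Section Quadrics.
Local Open Scope complex_scope.
Variable R : realType.
Local Notation C := (R[i]).

Lemma CexpD (z w : C) : Cexp (z + w) = Cexp z * Cexp w.
Proof.
case: z w => [a b] [c d]; rewrite /Cexp /= expRD cosD sinD.
by apply/eqP; rewrite eq_complex /=; apply/andP; split; apply/eqP; ring.
Qed.

Lemma conj_Cexp (z : C) : Num.conj (Cexp z) = Cexp z^*.
Proof.
case: z => a b; rewrite -[LHS]/((Cexp _)^*) /Cexp /= cosN sinN.
by apply/eqP; rewrite eq_complex /=; apply/andP; split; apply/eqP; ring.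
Qed.

Lemma Cexp_neq0 (z : C) : Cexp z != 0.
Proof.
apply/eqP => e; have : Cexp (z - z) = 0 by rewrite CexpD e mul0r.
rewrite subrr /Cexp /= expR0 cos0 sin0 => /eqP.
by rewrite eq_complex /= !(mul1r, mul0r, subr0) oner_eq0.
Qed.

Lemma Cexp_surj (z : C) : z != 0 -> exists w, Cexp w = z.
Proof.
case: z => a b; rewrite eq_complex /= negb_and => ab.
have ab_gt0 : 0 < a ^+ 2 + b ^+ 2.
  rewrite lt_def addr_ge0 ?sqr_ge0 // andbT paddr_eq0 ?sqr_ge0 //.
  by rewrite !sqrf_eq0 negb_and.
pose r := Num.sqrt (a ^+ 2 + b ^+ 2).
have r_gt0 : 0 < r by rewrite sqrtr_gt0.
have r0 : r != 0 by rewrite gt_eqF.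
have r2 : r ^+ 2 = a ^+ 2 + b ^+ 2 by rewrite sqr_sqrtr // ltW.
have ar : -1 <= a / r <= 1.
  rewrite -ler_norml -(@ler_pXn2r _ 2) ?nnegrE // expr1n real_normK ?num_real //.
  rewrite expr_div_n r2 ler_pdivrMr // mul1r lerDl; exact: sqr_ge0.
pose th := acos (a / r).
have cth : cos th = a / r by rewrite acosK // itv_boundlr /= ar.
have sth : sin th = `|b| / r.
  rewrite sin_acos // expr_div_n r2.
  have -> : 1 - a ^+ 2 / (a ^+ 2 + b ^+ 2) = (b / r) ^+ 2.
    by rewrite expr_div_n r2; field; rewrite gt_eqF.
  by rewrite sqrtr_sqr normf_div (gtr0_norm r_gt0).
(* [acos] determines the angle up to a sign, which the sign of [b] fixes. *)
exists (ln r +i* (if 0 <= b then th else - th)).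
rewrite /Cexp /= lnK ?posrE //; apply/eqP; rewrite eq_complex /=.
apply/andP; split; apply/eqP; case: ifPn => b0; rewrite ?cosN ?sinN cth sth.
- by field.
- by field.
- by rewrite ger0_norm //; field.
- by rewrite ltr0_norm ?ltNge //; field.
Qed.

(** The property is additive, so monomials suffice: [X_i X_j] has matrix [(E_ij + E_ji) / 2], also
    when [i = j]. *)
Lemma mpoly_quadratic (q : {mpoly C[4]}) : q \is 2.-homog ->
  exists Q : 'M[C]_4, [/\ Q^T = Q,
    forall v : 'cV[C]_4, q.@[fun i => v i 0] = bil Q v v &
    forall (v : 'cV[C]_4) i, (q^`M(i)).@[fun i => v i 0] = 2 * (Q *m v) i 0].
Proof.
move/dhomogP => hq; rewrite [q]mpolyE big_seq.
pose K (q : {mpoly C[4]}) := exists Q : 'M[C]_4, [/\ Q^T = Q,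
  forall v : 'cV[C]_4, q.@[fun i => v i 0] = bil Q v v &
  forall (v : 'cV[C]_4) i, (q^`M(i)).@[fun i => v i 0] = 2 * (Q *m v) i 0].
apply: (@big_ind _ K).
- exists 0; split=> [|v|v i]; first exact: trmx0.
    by rewrite meval0 /bil mulmx0 mul0mx mxE.
  by rewrite mderiv0 meval0 mul0mx mxE mulr0.
- move=> p1 p2 [Q1 [sQ1 e1 d1]] [Q2 [sQ2 e2 d2]]; exists (Q1 + Q2).
  split=> [|v|v i]; first by rewrite linearD /= sQ1 sQ2.
    by rewrite mevalD e1 e2 bil_add.
  by rewrite mderivD mevalD d1 d2 mulmxDl -mulrDr; congr (_ * _); rewrite [RHS]mxE.
move=> m /hq /= dm.
have [i mi] : exists i, m i != 0%N.
  apply/existsP; apply: contraT; rewrite negb_exists => /forallP m0.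
  suff m_eq0 : m = 0%MM by move: dm; rewrite m_eq0 mdeg0.
  by apply/mnmP => k; rewrite mnm0E; apply/eqP; have := m0 k; rewrite negbK.
have mE : m = (m - U_(i) + U_(i))%MM by rewrite submK // lep1mP.
have /mdeg1P[j /eqP mj] : mdeg (m - U_(i)) == 1%N.
  by move: dm; rewrite {1}mE mdegD mdeg1 addn1 => -[->].
have -> : 'X_[m] = 'X_j * 'X_i :> {mpoly C[4]} by rewrite mE mpolyXD mj.
have deltaE (k l : 'I_4) (v : 'cV[C]_4) :
    delta_mx k l *m v = v l 0 *: delta_mx k 0.
  apply/colP => h; rewrite !mxE (bigD1 l) //= !mxE !eqxx andbT big1 => [|g gl].
    by rewrite addr0 mulrC.
  by rewrite !mxE (negPf gl) andbF mul0r.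
have bil_delta k l (v : 'cV[C]_4) : bil (delta_mx k l) v v = v k 0 * v l 0.
  by rewrite /bil -mulmxA deltaE -scalemxAr -colE !mxE mulrC.
have derivX k l (v : 'I_4 -> C) : ('X_k^`M(l)).@[v] = (k == l)%:R.
  rewrite mderivX mnm1E mevalZ; case: eqP => [->|_]; last by rewrite mul0r.
  by rewrite -{1}[U_(l)%MM]add0m addmK mpolyX0 meval1 mulr1.
exists ((q@_m / 2) *: (delta_mx i j + delta_mx j i)); split=> [|v|v k].
- by rewrite linearZ linearD /= !trmx_delta addrC.
- rewrite mevalZ mevalM !mevalXU bil_scale bil_add !bil_delta.
  by field.
- rewrite mderivZ mevalZ mderivM mevalD !mevalM !derivX !mevalXU.
  rewrite -scalemxAl mxE mulmxDl mxE !deltaE !mxE !eqxx !andbT ![k == _]eq_sym.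
  by field.
Qed.

Lemma zero_set_equivalent (q q' : {mpoly C[4]}) (Q Q' : 'M[C]_4) :
  (forall v : 'cV[C]_4, q.@[fun i => v i 0] = bil Q v v) ->
  (forall v : 'cV[C]_4, q'.@[fun i => v i 0] = bil Q' v v) ->
  congruent Q Q' -> SO15_equivalent (zero_set q) (zero_set q').
Proof.
move=> qE q'E [P [c [qP uP c0 Q'E]]].
have [x x0 [dP1 qP1]] := quaternionic_normalize qP uP.
set g := x *: P in dP1 qP1.
have ug : g \in unitmx by rewrite unitmxE dP1 unitr1.
(* [Q'] is a multiple of the pullback of [Q] along [g], so [g] maps the zeros of [q'] to those of
   [q]; the inverse goes the required way. *)
exists (invmx g).
  split; first by rewrite det_inv dP1 invr1.
  exact: quaternionic_inv.
have zE (v : 'cV[C]_4) :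
    (q'.@[fun i => v i 0] == 0) = (q.@[fun i => (g *m v) i 0] == 0).
  rewrite qE q'E Q'E bil_scale mulf_eq0 (negPf c0) /=.
  have -> : bil (P^T *m Q *m P) v v = bil Q (P *m v) (P *m v).
    by rewrite /bil trmx_mul !mulmxA.
  by rewrite /g -scalemxAl bilZl bilZr !mulf_eq0 (negPf x0).
have actE (h : 'M[C]_4) (L : {vspace 'cV[C]_4}) (v : 'cV[C]_4) : h \in unitmx ->
    (v \in proj_act h L) = (invmx h *m v \in L).
  move=> uh; apply/memv_imgP/idP => [[u uL ->]|vL].
    by rewrite lfunE /= mulKmx.
  by exists (invmx h *m v) => //; rewrite lfunE /= mulKVmx.
have dimE (h : 'M[C]_4) (L : {vspace 'cV[C]_4}) : h \in unitmx ->
    \dim (proj_act h L) = \dim L.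
  move=> uh; apply: limg_dim_eq.
  suff /lker0P/eqP -> : injective (linfun (mulmx h : 'cV[C]_4 -> 'cV[C]_4)).
    exact: capv0.
  by move=> u v; rewrite !lfunE /=; apply: (can_inj (mulKmx uh)).
have uh : invmx g \in unitmx by rewrite unitmx_inv.
apply/seteqP; split=> [_ [L [dL zL] <-]|L [dL zL]].
  split; first by rewrite /CP3 /= dimE.
  by move=> v; rewrite actE // invmxK => /zL/eqP; rewrite -zE => /eqP.
exists (proj_act g L).
  split; first by rewrite /CP3 /= dimE.
  move=> v; rewrite actE // => /zL/eqP; rewrite zE => /eqP.
  by rewrite mulKVmx.
by apply/vspaceP => v; rewrite !actE // invmxK mulKmx.
Qed.

Lemma diagonal_formE (l m n : R) (v : 'cV[C]_4) :
  (diagonal_form l m n).@[fun i => v i 0] = bil (diag4 (Cexp (l +i* n))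
    (Cexp (- l +i* n)) (Cexp (m +i* - n)) (Cexp (- m +i* - n))) v v.
Proof.
rewrite /diagonal_form !expr2 !mevalD !mevalZ !mevalM !mevalXU.
by rewrite /bil mul_mx_diag mxE sum_ord4 !mxE /=; ring.
Qed.

Lemma exceptional_formE (k : R) (v : 'cV[C]_4) :
  (exceptional_form k).@[fun i => v i 0] = bil (exceptional_mx k%:C) v v.
Proof.
rewrite /exceptional_form !expr2 !(mevalD, mevalN, mevalZ, mevalM) !mevalXU.
by rewrite bil_natmx !sum_ord4 /=; field.
Qed.

(* On logarithms of the entries the normalisation is a real linear system. *)
Lemma diag4_normalize (x y z t : C) : x * y * z * t != 0 ->
  exists l m n : R, congruent (diag4 x y z t) (diag4 (Cexp (l +i* n))
    (Cexp (- l +i* n)) (Cexp (m +i* - n)) (Cexp (- m +i* - n))).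
Proof.
rewrite !mulf_eq0 !negb_or => /andP[/andP[/andP[x0 y0] z0] t0].
have [[x1 x2] <-] := Cexp_surj x0; have [[y1 y2] <-] := Cexp_surj y0.
have [[z1 z2] <-] := Cexp_surj z0; have [[t1 t2] <-] := Cexp_surj t0.
(* [a] makes the four phases sum to zero; within each pair, the real parts of [p] and [q] make the
   moduli reciprocal and their imaginary parts make the phases equal. *)
pose a : C := 0 +i* (- (x2 + y2 + z2 + t2) / 4).
pose p : C := (- (x1 + y1) / 4) +i* ((y2 - x2) / 4).
pose q : C := (- (z1 + t1) / 4) +i* ((t2 - z2) / 4).
exists ((x1 - y1) / 2), ((z1 - t1) / 2), ((x2 + y2 - z2 - t2) / 4).
have := diag4_congruent (Cexp (x1 +i* x2)) (Cexp (y1 +i* y2)) (Cexp (z1 +i* z2))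
  (Cexp (t1 +i* t2)) (Cexp_neq0 a) (Cexp_neq0 p) (Cexp_neq0 q).
congr (congruent _ (diag4 _ _ _ _)); rewrite ?conj_Cexp expr2 -!CexpD;
  by congr Cexp; apply/eqP; rewrite eq_complex /=; apply/andP; split;
  apply/eqP; field.
Qed.

Lemma twistor_mx_exceptional (l : C) : 1 <= l -> exists k : R,
  0 <= k < 1 /\ congruent (twistor_mx l) (exceptional_mx k%:C).
Proof.
(* The order on complex numbers forces [l] to be real. *)
case: l => a b; rewrite lecE /= => /andP[/eqP -> a1].
have a1_gt0 : 0 < a + 1 by rewrite addr_gt0 // (lt_le_trans ltr01).
pose k := (a - 1) / (a + 1).
have k01 : 0 <= k < 1.
  rewrite divr_ge0 ?subr_ge0 ?(ltW a1_gt0) //= ltr_pdivrMr // mul1r.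
  by rewrite ltrD2l (lt_trans _ ltr01) // oppr_lt0.
exists k; split=> //; apply: congruent_sym.
have divE (r : R) : (1 + r%:C) / (1 - r%:C) = ((1 + r) / (1 - r))%:C.
  by rewrite fmorph_div rmorphB rmorphD rmorph1.
have -> : (a +i* 0 : C) = (1 + k%:C) / (1 - k%:C).
  rewrite divE; congr (_ +i* _); rewrite /k; field.
  have -> : a + 1 - (a - 1) = 2 by ring.
  by rewrite gt_eqF // pnatr_eq0.
apply: (@exceptional_mx_congruent C).
by rewrite -[0]/(0%:C) -[1]/(1%:C) lecR ltcR.
Qed.

End Quadrics.

Theorem theorem1p9 (R : realType) (S : set {vspace 'cV[R[i]]_4}) :
  nonsingular_quadric S ->
  (exists l m n : R, SO15_equivalent S (zero_set (diagonal_form l m n))) \/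
  (exists k : R, 0 <= k < 1 /\
     SO15_equivalent S (zero_set (exceptional_form k))).
Proof.
case=> q [hq nq ->]; have [Q [symQ qE dqE]] := mpoly_quadratic hq.
have uQ : Q \in unitmx.
  (* A kernel vector of [Q] would be a zero of [q] at which the gradient vanishes. *)
  rewrite unitmxE unitfE; apply/negP => /det0P[r r0 rQ].
  have Qr : Q *m r^T = 0 by apply: trmx_inj; rewrite trmx_mul trmxK symQ rQ trmx0.
  have [||i] := nq r^T; last by rewrite dqE Qr mxE mulr0 eqxx.
    by rewrite -(inj_eq (@trmx_inj _ _ _)) trmxK trmx0.
  by rewrite qE /bil -mulmxA Qr mulmx0 mxE.
have [[x [y [z [t [nz cQ]]]]]|[l l1 cQ]] := quaternionic_normal_form symQ uQ.
  have [l [m [n cD]]] := diag4_normalize nz.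
  left; exists l, m, n.
  exact: (zero_set_equivalent qE (diagonal_formE l m n) (congruent_trans cQ cD)).
have [k [k01 cE]] := twistor_mx_exceptional l1.
right; exists k; split=> //.
exact: (zero_set_equivalent qE (exceptional_formE k) (congruent_trans cQ cE)).
Qed.
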